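(* Let $D=(d_{jl}),P=(p_{ik})\in\mathbb{R}^{n\times n}$, let $a,b\in\{1,\dots,n\}$ and let $(x^\star,z^\star)\in LXY(D,P)$ be a solution of the relaxed linearization of Xia and Yuan. Consider a (not necessarily optimal) dual feasible solution $(\beta^1_{lab},\beta^2_{kab},\delta_{kl})_{k\ne a,\,l\ne b}\in\mathbb{R}^{2(n-1)+(n-1)^2}$ of the separation problem $$\begin{aligned} sep=\min\ &\sum_{k\neq a,\,l\neq b}p_{ak}d_{bl}x_{kl}\\ \text{s.t.}\ &-\sum_{k\ne a}x_{kl}=-x^\star_{ab}\quad\forall\, l\ne b &&(\beta^1_{lab})\\ &-\sum_{l\ne b}x_{kl}=-x^\star_{ab}\quad\forall\, k\ne a &&(\beta^2_{kab})\\ &x_{kl}\ge0\quad\forall\, k\ne a,\ l\ne b\\ &-x_{kl}\ge-x^\star_{kl}\quad\forall\, k\ne a,\ l\ne b &&(\delta_{kl}) \end{aligned}$$ and denote its dual objective value by $sep_{dual}(\beta^1_{lab},\beta^2_{kab},\delta_{kl})$. Then the inequality (the $ab$-cut) $$z_{ab}\ge-\left(\sum_{l\ne b}\beta^1_{lab}+\sum_{k\ne a}\beta^2_{kab}\right)x_{ab}-\sum_{k\ne a,\,l\ne b}\delta_{kl}x_{kl}$$ is valid for the quadratic assignment problem. Furthermore, the $ab$-cut is violated by $(x^\star,z^\star)$ if $sep_{dual}(\beta^1_{lab},\beta^2_{kab},\delta_{kl})>z^\star_{ab}$, and there is no $ab$-cut (for this pair $(a,b)$, arising from any dual feasible solution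 of this separation problem) violated by $(x^\star,z^\star)$ if $sep\le z^\star_{ab}$.
   Context: All indices $i,j,k,l$ range over $\{1,\dots,n\}$. Let $X_n$ be the set of $n\times n$ permutation matrices ($x_{ij}\in\{0,1\}$, all row and column sums equal to 1) and $LX_n$ the set of real $n\times n$ matrices with nonnegative entries and all row and column sums equal to 1. For $i,j$ define $u_{ij}$ and $l_{ij}$ as the maximum and minimum, respectively, of $\sum_{k\ne i,\,l\ne j}p_{ik}d_{jl}x_{kl}$ over all permutation matrices $x=(x_{kl})_{k\ne i,\,l\ne j}$ of size $n-1$ (rows indexed by $\{1,\dots,n\}\setminus\{i\}$, columns by $\{1,\dots,n\}\setminus\{j\}$). $LXY(D,P)$ is the set of $(x,z)\in\mathbb{R}^{n^2}\times\mathbb{R}^{n^2}$ with $x\in LX_n$ and, for all $i,j$, $z_{ij}\ge l_{ij}x_{ij}$ and $z_{ij}\ge\sum_{k\neq i,\,l\neq j}p_{ik}d_{jl}x_{kl}+u_{ij}(x_{ij}-1)$. In this linearization $z_{ij}$ represents $x_{ij}\sum_{k\ne i,\,l\ne j}p_{ik}d_{jl}x_{kl}$. An inequality in $(x,z)$ is valid for the quadratic assignment problem if it is satisfied by every $(x,z)$ with $x\in X_n$ and $z_{ij}=x_{ij}\sum_{k\ne i,\,l\ne j}p_{ik}d_{jl}x_{kl}$ for all $i,j$. The dual of the separation problem is $$\max\ -x^\star_{ab}\left(\sum_{l\ne b}\beta^1_{lab}+\sum_{k\ne a}\beta^2_{kab}\right)-\sum_{k\ne a,\,l\ne b}x^\star_{kl}\delta_{kl}$$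 subject to $-\beta^1_{lab}-\beta^2_{kab}\le p_{ak}d_{bl}+\delta_{kl}$ and $\delta_{kl}\ge0$ for all $k\ne a$, $l\ne b$; the variables $\beta^1_{lab},\beta^2_{kab}$ are real and unrestricted in sign. $sep$ denotes the optimal primal objective value (with the usual convention $sep=+\infty$ if the primal is infeasible). An inequality is violated by $(x^\star,z^\star)$ if it does not hold at $(x,z)=(x^\star,z^\star)$. *)

(* Defs.v *)
From mathcomp Require Import all_boot all_order all_fingroup all_algebra.
From mathcomp Require Import all_classical all_reals ereal.

Set Implicit Arguments.
Unset Strict Implicit.
Unset Printing Implicit Defensive.

Import Order.TTheory GRing.Theory Num.Theory.

Local Open Scope classical_set_scope.
Local Open Scope ring_scope.

(* Indices in {1..n} \ {i} are represented by 'I_n.-1 through [lift i], so a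
   family (y_kl) with k <> i and l <> j is a matrix y : 'M_n.-1 whose (k, l)
   entry stands for y_(lift i k, lift j l). *)

Definition perm_matrix (R : realType) (n : nat) : set 'M[R]_n :=
  [set x : 'M[R]_n | [/\ forall i j, x i j = 0 \/ x i j = 1,
               forall i, \sum_j x i j = 1
             & forall j, \sum_i x i j = 1]].

Definition doubly_stochastic (R : realType) (n : nat) : set 'M[R]_n :=
  [set x : 'M[R]_n | [/\ forall i j, 0 <= x i j,
               forall i, \sum_j x i j = 1
             & forall j, \sum_i x i j = 1]].

Lemma sum01_uniq (R : realType) (n : nat) (f : 'I_n -> R) (i j : 'I_n) :
  (forall k, f k = 0 \/ f k = 1) -> \sum_k f k = 1 ->
  f i = 1 -> f j = 1 -> i = j.
Proof.
move=> f01 sf fi fj; apply/eqP/negPn/negP => nij.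
have f0 k : 0 <= f k by case: (f01 k) => ->.
move: sf; rewrite (bigD1 i) //= (bigD1 j) /=; last by rewrite eq_sym.
rewrite fi fj -[RHS]addr0 => /addrI /eqP.
rewrite paddr_eq0 ?ler01 ?oner_eq0 //.
by apply: sumr_ge0.
Qed.

(* [perm_matrix] agrees with the library's [perm_mx]. *)
Lemma perm_matrixP (R : realType) (n : nat) (x : 'M[R]_n) :
  perm_matrix x <-> exists s : 'S_n, x = perm_mx s.
Proof.
split=> [[x01 xr xc]|[s ->]].
  have ex1 i : exists j, x i j == 1.
    case: (boolP [exists j, x i j == 1]) => [/existsP //|].
    rewrite negb_exists => /forallP h.
    have /eqP := xr i; rewrite big1 1?eq_sym ?oner_eq0 // => j _.
    by case: (x01 i j) => // e; move: (h j); rewrite e eqxx.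
  pose f i := xchoose (ex1 i).
  have xf i : x i (f i) = 1 by apply/eqP/(xchooseP (ex1 i)).
  have injf : injective f.
    move=> i i' e; apply: (@sum01_uniq _ _ (fun k => x k (f i))) => //.
    by rewrite e.
  exists (perm injf); apply/matrixP => i j; rewrite !mxE permE.
  case: eqP => [<-|ne]; first exact: xf.
  case: (x01 i j) => // e; case: ne.
  exact: (@sum01_uniq _ _ (x i)).
split=> [i j|i|j].
- by rewrite !mxE; case: eqP; [right|left].
- rewrite (bigD1 (s i)) //= big1 => [|j nj]; rewrite !mxE ?eqxx ?addr0 //.
  by rewrite eq_sym (negPf nj).
- rewrite (bigD1 ((s^-1)%g j)) //= big1 => [|i ni].
    by rewrite !mxE permKV eqxx addr0.
  rewrite !mxE; case: eqP => // e; move: ni.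
  by rewrite -e permK eqxx.
Qed.

(* sum over k <> i, l <> j of p_ik d_jl y_kl *)
Definition inner (R : realType) (n : nat) (D P : 'M[R]_n) (i j : 'I_n)
    (y : 'M[R]_n.-1) : R :=
  \sum_k \sum_l P i (lift i k) * D j (lift j l) * y k l.

(* (x_kl) with k <> i, l <> j *)
Definition minor_mx (R : realType) (n : nat) (i j : 'I_n) (x : 'M[R]_n) :
    'M[R]_n.-1 := row' i (col' j x).

(* The iterated max/min starts from the value at the identity, which is itself
   one of the candidates; by [perm_matrixP] the range is all permutation
   matrices of size n - 1. *)
Definition u_bound (R : realType) (n : nat) (D P : 'M[R]_n) (i j : 'I_n) : R :=
  \big[Num.max/inner D P i j (perm_mx 1%g)]_(s : 'S_n.-1)
    inner D P i j (perm_mx s).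

Definition l_bound (R : realType) (n : nat) (D P : 'M[R]_n) (i j : 'I_n) : R :=
  \big[Num.min/inner D P i j (perm_mx 1%g)]_(s : 'S_n.-1)
    inner D P i j (perm_mx s).

Definition LXY (R : realType) (n : nat) (D P : 'M[R]_n) :
    set ('M[R]_n * 'M[R]_n) :=
  [set xz : 'M[R]_n * 'M[R]_n | doubly_stochastic xz.1 /\
     forall i j,
       l_bound D P i j * xz.1 i j <= xz.2 i j /\
       inner D P i j (minor_mx i j xz.1) + u_bound D P i j * (xz.1 i j - 1)
         <= xz.2 i j].

(* An inequality in (x, z) is represented by the set of its solutions. *)
Definition qap_valid (R : realType) (n : nat) (D P : 'M[R]_n)
    (ineq : set ('M[R]_n * 'M[R]_n)) : Prop :=
  forall x z : 'M[R]_n, perm_matrix x ->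
    (forall i j, z i j = x i j * inner D P i j (minor_mx i j x)) ->
    ineq (x, z).

Definition violated (R : realType) (n : nat)
    (ineq : set ('M[R]_n * 'M[R]_n)) (x z : 'M[R]_n) : Prop :=
  ~ ineq (x, z).

Definition sep_feasible (R : realType) (n : nat) (a b : 'I_n) (x : 'M[R]_n) :
    set 'M[R]_n.-1 :=
  [set y : 'M[R]_n.-1 | [/\ forall l, - \sum_k y k l = - x a b,
               forall k, - \sum_l y k l = - x a b,
               forall k l, 0 <= y k l
             & forall k l, - minor_mx a b x k l <= - y k l]].

(* Equal to +oo when the problem is infeasible. *)
Definition sep (R : realType) (n : nat) (D P : 'M[R]_n) (a b : 'I_n)
    (x : 'M[R]_n) : \bar R :=
  ereal_inf [set (inner D P a b y)%:E | y in sep_feasible a b x].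

Definition dual_feasible (R : realType) (n : nat) (D P : 'M[R]_n)
    (a b : 'I_n) (beta1 beta2 : 'I_n.-1 -> R) (delta : 'M[R]_n.-1) : Prop :=
  forall k l,
    - beta1 l - beta2 k <= P a (lift a k) * D b (lift b l) + delta k l /\
    0 <= delta k l.

Definition sep_dual (R : realType) (n : nat) (a b : 'I_n) (x : 'M[R]_n)
    (beta1 beta2 : 'I_n.-1 -> R) (delta : 'M[R]_n.-1) : R :=
  - x a b * (\sum_l beta1 l + \sum_k beta2 k)
  - \sum_k \sum_l minor_mx a b x k l * delta k l.

Definition ab_cut (R : realType) (n : nat) (a b : 'I_n)
    (beta1 beta2 : 'I_n.-1 -> R) (delta : 'M[R]_n.-1) :
    set ('M[R]_n * 'M[R]_n) :=
  [set xz : 'M[R]_n * 'M[R]_n | - (\sum_l beta1 l + \sum_k beta2 k) * xz.1 a b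
            - \sum_k \sum_l delta k l * minor_mx a b xz.1 k l <= xz.2 a b].

(* Main.v *)
Require Import Defs.
From mathcomp Require Import all_boot all_order all_fingroup all_algebra.
From mathcomp Require Import all_classical all_reals ereal.

Import Order.TTheory GRing.Theory Num.Theory.

Local Open Scope ring_scope.

(** The whole theorem is weak duality, applied at two different points.  Let y
    be a nonnegative matrix of size n - 1 whose row and column sums all equal
    t.  Multiplying the dual constraints by the entries of y and adding them up
    bounds the objective of the separation problem at y from below by
    -t (sum beta1 + sum beta2) - sum delta y ([dual_bound]).

    - Validity: take for y the minor of a permutation matrix x at (a, b).  If
      x_ab = 1, this minor is again doubly stochastic ([minor_mx_line_sums]),
      and the bound with t = 1 is the cut.  If x_ab = 0, then z_ab = 0, while
      the right-hand side of the cut is -sum delta x <= 0.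
    - Separation: the right-hand side of the cut at (xs, zs) is the dual
      objective value, so that the cut is violated exactly when this value
      exceeds zs_ab ([violated_ab_cutE]).  The bound with t = xs_ab and the
      constraints y <= xs show that the dual value is a lower bound of the
      primal values, hence of their infimum [sep] ([sep_dual_le_sep]).
      Therefore sep <= zs_ab excludes every violated cut. *)

(** The term in delta is kept at y, rather than estimated through the upper
    bounds of the separation problem: this is the form that the cut requires
    when y is a minor of a permutation matrix. *)
Lemma dual_bound {R : realType} {n : nat} {D P : 'M[R]_n} {a b : 'I_n}
    {beta1 beta2 : 'I_n.-1 -> R} {delta y : 'M[R]_n.-1} {t : R} :
  dual_feasible D P a b beta1 beta2 delta ->
  (forall k l, 0 <= y k l) ->
  (forall k, \sum_l y k l = t) -> (forall l, \sum_k y k l = t) ->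
  - t * (\sum_l beta1 l + \sum_k beta2 k) - \sum_k \sum_l delta k l * y k l
    <= inner D P a b y.
Proof.
move=> df y0 yr yc.
have -> : - t * (\sum_l beta1 l + \sum_k beta2 k) =
    \sum_k \sum_l (- beta1 l - beta2 k) * y k l.
  under [RHS]eq_bigr do under eq_bigr do rewrite mulrBl mulNr.
  under [RHS]eq_bigr do rewrite sumrB sumrN.
  rewrite sumrB sumrN exchange_big /= mulNr mulrDr opprD !mulr_sumr.
  congr (- _ - _); apply: eq_bigr => i _; rewrite -mulr_sumr.
    by rewrite yc mulrC.
  by rewrite yr mulrC.
rewrite lerBlDr /inner -big_split ler_sum //= => k _.
rewrite -big_split ler_sum //= => l _.
by rewrite -mulrDl ler_wpM2r ?y0 //; case: (df k l).
Qed.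

Lemma perm_matrix_doubly_stochastic {R : realType} {n : nat} {x : 'M[R]_n} :
  perm_matrix x -> doubly_stochastic x.
Proof. by case=> x01 xr xc; split=> // i j; case: (x01 i j) => ->. Qed.

(** An entry 1 exhausts its row and its column, so deleting both removes only
    zeros from the other lines. *)
Lemma minor_mx_line_sums {R : realType} {n : nat} {x : 'M[R]_n} {a b : 'I_n} :
  doubly_stochastic x -> x a b = 1 ->
  (forall k, \sum_l minor_mx a b x k l = 1) /\
  (forall l, \sum_k minor_mx a b x k l = 1).
Proof.
move=> [x0 xr xc] xab; split=> [k|l].
- have xkb : x (lift a k) b = 0.
    have := xc b; rewrite (bigD1_ord a) //= xab -[RHS]addr0 => /addrI.
    by move=> /psumr_eq0P; apply.
  rewrite -(xr (lift a k)) [RHS](bigD1_ord b) //= xkb add0r.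
  by apply: eq_bigr => l _; rewrite !mxE.
- have xal : x a (lift b l) = 0.
    have := xr a; rewrite (bigD1_ord b) //= xab -[RHS]addr0 => /addrI.
    by move=> /psumr_eq0P; apply.
  rewrite -(xc (lift b l)) [RHS](bigD1_ord a) //= xal add0r.
  by apply: eq_bigr => k _; rewrite !mxE.
Qed.

Lemma ab_cut_valid {R : realType} {n : nat} {D P : 'M[R]_n} {a b : 'I_n}
    {beta1 beta2 : 'I_n.-1 -> R} {delta : 'M[R]_n.-1} :
  dual_feasible D P a b beta1 beta2 delta ->
  qap_valid D P (ab_cut a b beta1 beta2 delta).
Proof.
move=> df x z xP zE; have xS := perm_matrix_doubly_stochastic xP.
have y0 k l : 0 <= minor_mx a b x k l by case: xS => x0 _ _; rewrite !mxE.
rewrite /ab_cut /= zE; have [x01 _ _] := xP; case: (x01 a b) => xab.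
  rewrite xab mulr0 mul0r sub0r oppr_le0; apply: sumr_ge0 => k _.
  by apply: sumr_ge0 => l _; rewrite mulr_ge0 //; case: (df k l).
have [yr yc] := minor_mx_line_sums xS xab.
by have := dual_bound df y0 yr yc; rewrite xab mulN1r mulr1 mul1r.
Qed.

Lemma violated_ab_cutE {R : realType} {n : nat} {a b : 'I_n} {x z : 'M[R]_n}
    {beta1 beta2 : 'I_n.-1 -> R} {delta : 'M[R]_n.-1} :
  violated (ab_cut a b beta1 beta2 delta) x z <->
  z a b < sep_dual a b x beta1 beta2 delta.
Proof.
have -> : sep_dual a b x beta1 beta2 delta =
    - (\sum_l beta1 l + \sum_k beta2 k) * x a b
    - \sum_k \sum_l delta k l * minor_mx a b x k l.
  rewrite /sep_dual !mulNr [x a b * _]mulrC; congr (_ - _).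
  by apply: eq_bigr => k _; apply: eq_bigr => l _; rewrite mulrC.
by rewrite /violated /ab_cut /= ltNge; split=> /negP.
Qed.

Lemma sep_dual_le_sep {R : realType} {n : nat} {D P : 'M[R]_n} {a b : 'I_n}
    (x : 'M[R]_n) {beta1 beta2 : 'I_n.-1 -> R} {delta : 'M[R]_n.-1} :
  dual_feasible D P a b beta1 beta2 delta ->
  ((sep_dual a b x beta1 beta2 delta)%:E <= sep D P a b x)%E.
Proof.
move=> df; apply: le_ereal_inf_tmp => _ [y [yc yr y0 yx] <-].
rewrite lee_fin; apply: le_trans (dual_bound df y0 _ _); first last.
- by move=> l; apply: oppr_inj; exact: yc.
- by move=> k; apply: oppr_inj; exact: yr.
rewrite /sep_dual lerD2l lerN2; apply: ler_sum => k _; apply: ler_sum => l _.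
have [_ d0] := df k l.
by rewrite mulrC ler_wpM2r // -lerN2.
Qed.

Theorem theorem3 (R : realType) (n : nat) (D P : 'M[R]_n) (a b : 'I_n)
    (xs zs : 'M[R]_n) (hxz : LXY D P (xs, zs)) :
  (forall (beta1 beta2 : 'I_n.-1 -> R) (delta : 'M[R]_n.-1),
     dual_feasible D P a b beta1 beta2 delta ->
     qap_valid D P (ab_cut a b beta1 beta2 delta) /\
     (zs a b < sep_dual a b xs beta1 beta2 delta ->
      violated (ab_cut a b beta1 beta2 delta) xs zs)) /\
  ((sep D P a b xs <= (zs a b)%:E)%E ->
   ~ exists (beta1 beta2 : 'I_n.-1 -> R) (delta : 'M[R]_n.-1),
       dual_feasible D P a b beta1 beta2 delta /\
       violated (ab_cut a b beta1 beta2 delta) xs zs).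
Proof.
split=> [beta1 beta2 delta df|sep_le [beta1 [beta2 [delta [df viol]]]]].
  by split; [exact: ab_cut_valid|move/violated_ab_cutE].
move/violated_ab_cutE: viol; rewrite ltNge -lee_fin => /negP; apply.
exact: le_trans (sep_dual_le_sep _ df) sep_le.
Qed.
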